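(* For all integers $a\ge 2$ and $c\ge 2$, $$\Gamma(a,ca-1)=\begin{cases}0,&\text{if } a\text{ is even and } c\text{ is odd},\\ 1,&\text{otherwise.}\end{cases}$$
   Context: For coprime positive integers $a,b$, it is known that exactly one of the two equations $ax+by=\frac{(a-1)(b-1)}{2}$ and $1+ax+by=\frac{(a-1)(b-1)}{2}$ has a solution in nonnegative integers $x,y$. Define $\Gamma(a,b)=0$ if the first equation has such a solution, and $\Gamma(a,b)=1$ if the second does. *)

(* Defs.v *)
From mathcomp Require Import all_boot boolp zify.

Set Implicit Arguments.
Unset Strict Implicit.
Unset Printing Implicit Defensive.

(* For coprime positive a and b at least one of them is odd, so the division
   by 2 is exact (half_prodK). *)
Definition half_prod (a b : nat) : nat := (a.-1 * b.-1) %/ 2.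

Definition first_solvable (a b : nat) : Prop :=
  exists x y : nat, a * x + b * y = half_prod a b.

Definition second_solvable (a b : nat) : Prop :=
  exists x y : nat, 1 + a * x + b * y = half_prod a b.

(* The value 2 is junk: [Gamma_exactly_one] shows that it does not occur for
   coprime positive arguments, and that the order of the tests is irrelevant. *)
Definition Gamma (a b : nat) : nat :=
  if `[< first_solvable a b >] then 0
  else if `[< second_solvable a b >] then 1
  else 2.

Lemma half_prodK (a b : nat) : 0 < a -> 0 < b -> coprime a b ->
  (half_prod a b).*2 = a.-1 * b.-1.
Proof.
move=> a0 b0 cab; rewrite /half_prod divn2 even_halfK// oddM.
apply/negP => /andP[oa ob].
have ea : 2 %| a by rewrite dvdn2; lia.
have eb : 2 %| b by rewrite dvdn2; lia.
have : 2 %| gcdn a b by rewrite dvdn_gcd ea eb.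
by rewrite (eqP cab).
Qed.

Lemma Gamma_exactly_one (a b : nat) : 0 < a -> 0 < b -> coprime a b ->
  (first_solvable a b \/ second_solvable a b) /\
  ~ (first_solvable a b /\ second_solvable a b).
Proof.
move=> a0 b0 cab; have := half_prodK a0 b0 cab.
rewrite /first_solvable /second_solvable; move: (half_prod a b) => N NE.
split.
  have [u _ /eqP] : exists2 u, true & a * u == 1 %[mod b].
    case: (egcdnP b a0) => u v; rewrite (eqP cab) => e _; exists u => //.
    by rewrite mulnC e modnMDl.
  move=> au1; pose x := (u * N) %% b.
  have xb : x < b by rewrite ltn_pmod.
  have axN : a * x = N %[mod b].
    by rewrite modnMmr mulnA -modnMml au1 modnMml mul1n.
  move: x xb axN => {u au1} x xb axN.
  have [le|lt] := leqP (a * x) N.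
    left; exists x, ((N - a * x) %/ b).
    have /divnK e : b %| N - a * x by rewrite -eqn_mod_dvd// axN.
    by rewrite [b * (_ %/ b)]mulnC e subnKC.
  right; have /divnK : b %| a * x - N by rewrite -eqn_mod_dvd ?axN// ltnW.
  move: (_ %/ b) => k e; exists (b.-1 - x), k.-1.
  case: k e => [|k] e; first by lia.
  have [z bE] : exists z, b = (x + z).+1 by exists (b.-1 - x); lia.
  case: a a0 lt e NE {cab axN} => // a _ lt e NE.
  have -> : b.-1 - x = z by rewrite bE; lia.
  move: e NE lt; rewrite bE /= => e NE lt.
  by lia.
move=> [[x [y e1]] [x' [y' e2]]].
have e : a * (x + x').+1 + b * (y + y').+1 = a * b.
  case: a a0 e1 e2 NE {cab} => // a _; case: b b0 => // b _ /= e1 e2 NE; lia.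
have bx : b %| (x + x').+1.
  rewrite -(@Gauss_dvdr _ a) 1?coprime_sym//.
  by rewrite -(dvdn_addl _ (dvdn_mulr (y + y').+1 (dvdnn b))) e dvdn_mull.
have ay : a %| (y + y').+1.
  rewrite -(@Gauss_dvdr _ b)//.
  by rewrite -(dvdn_addr _ (dvdn_mulr (x + x').+1 (dvdnn a))) e dvdn_mulr.
have lx : a * b <= a * (x + x').+1 by rewrite leq_mul2l dvdn_leq ?orbT.
have ly : a * b <= b * (y + y').+1 by rewrite mulnC leq_mul2l dvdn_leq ?orbT.
have ab0 : 0 < a * b by rewrite muln_gt0 a0.
lia.
Qed.

Lemma Gamma_eq0 (a b : nat) : Gamma a b = 0 <-> first_solvable a b.
Proof.
rewrite /Gamma; case: asboolP => [h1|nh1]; first by [].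
by case: asboolP => _; split.
Qed.

Lemma Gamma_eq1 (a b : nat) : 0 < a -> 0 < b -> coprime a b ->
  Gamma a b = 1 <-> second_solvable a b.
Proof.
move=> a0 b0 cab; have [_ nboth] := Gamma_exactly_one a0 b0 cab.
rewrite /Gamma; case: asboolP => [h1|_]; last by case: asboolP; split.
by split=> // h2; case: nboth.
Qed.

(* Main.v *)
Require Import Defs.
From mathcomp Require Import all_boot.
From mathcomp Require Import zify.

(** Write [b = c * a - 1] and [N = (a - 1) * (b - 1) / 2].  Since [b] is
    congruent to [-1] modulo [a], the coefficient [y] in [a * x + b * y = N]
    is determined modulo [a] by [N] alone, which leads to explicit solutions:
    - if [a = 2k] and [c = 2d + 1], then [N = 1 + k] modulo [a], so [y = k - 1],
      and then [x = d] solves the first equation;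
    - if [a = 2k + 1], or if [a = 2k] and [c = 2d], then [N = 1] modulo [a], so
      [y = 0] solves the second equation, with [x = k * c - 1] in the former
      case and [x = d * (2k - 1) - 1] in the latter.
    As [a] and [b] are coprime, the two equations are not both solvable, so a
    solution of either one determines the value of [Gamma]. *)

Lemma coprime_mul_sub1 (a c : nat) : 0 < c * a -> coprime a (c * a - 1).
Proof.
move=> ca0; apply: (@coprime_dvdl a (c * a)); first exact: dvdn_mull.
by rewrite subn1 coprimenP.
Qed.

Lemma first_solvable_even_odd (k d : nat) : 0 < k ->
  first_solvable k.*2 (d.*2.+1 * k.*2 - 1).
Proof.
case: k => // k _; exists d, k.
suff -> : half_prod k.+1.*2 (d.*2.+1 * k.+1.*2 - 1)
          = k.*2.+1 * (d.*2.+1 * k.+1).-1 by nia.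
rewrite /half_prod.
have -> : (k.+1.*2).-1 * (d.*2.+1 * k.+1.*2 - 1).-1
          = k.*2.+1 * (d.*2.+1 * k.+1).-1 * 2 by nia.
by rewrite mulnK.
Qed.

Lemma second_solvable_odd (k c : nat) : 0 < k -> 0 < c ->
  second_solvable k.*2.+1 (c * k.*2.+1 - 1).
Proof.
move=> k0 c0; exists (k * c).-1, 0.
rewrite /half_prod.
have -> : k.*2.+1.-1 * (c * k.*2.+1 - 1).-1 = k * (c * k.*2.+1 - 2) * 2 by nia.
rewrite mulnK //.
case: k k0 c c0 => // k _ [] // c _; nia.
Qed.

Lemma second_solvable_even_even (k d : nat) : 0 < k -> 0 < d ->
  second_solvable k.*2 (d.*2 * k.*2 - 1).
Proof.
case: k d => [|k] [|d] // _ _; exists (d.+1 * k.*2.+1).-1, 0.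
rewrite /half_prod.
have -> : (k.+1.*2).-1 * (d.+1.*2 * k.+1.*2 - 1).-1
          = k.*2.+1 * (d.+1.*2 * k.+1).-1 * 2 by nia.
rewrite mulnK //; nia.
Qed.

Theorem theorem4p6 (a c : nat) (ha : 2 <= a) (hc : 2 <= c) :
  Gamma a (c * a - 1) = if ~~ odd a && odd c then 0 else 1.
Proof.
have Gamma1 : second_solvable a (c * a - 1) -> Gamma a (c * a - 1) = 1.
  by apply: (Gamma_eq1 _ _ _).2; [lia | nia | apply: coprime_mul_sub1; nia].
have aE := odd_double_half a; have cE := odd_double_half c.
case oa: (odd a) aE => /= aE.
  by apply: Gamma1; rewrite -aE; apply: second_solvable_odd; lia.
case oc: (odd c) cE => /= cE.
  by apply/Gamma_eq0; rewrite -aE -cE; apply: first_solvable_even_odd; lia.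
by apply: Gamma1; rewrite -aE -cE; apply: second_solvable_even_even; lia.
Qed.
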